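(* Let $\bar{\mathcal K}=\{\mathcal K_n\}_{n<\omega}$ be a sequence of families of finite-dimensional normed spaces. (a) If each $\mathcal K_n$ is hereditary, then so are $\langle\bar{\mathcal K}\rangle_{<\alpha}$ and $\langle\bar{\mathcal K}\rangle_{\le\alpha}$ for each $\alpha\le\omega$. (b) Suppose each $\mathcal K_n$ is an amalgamation class with modulus of stability $\varpi^{\mathcal K_n}:\mathbb N\times[0,\infty[\,\to[0,\infty[$. Then for each $\alpha\le\omega$ the class $\langle\bar{\mathcal K}\rangle_{<\alpha}$ is also an amalgamation class, with modulus of stability $\varpi(d,l,\delta):=\max_{n<l}\varpi^{\mathcal K_n}(d,\delta)$. Furthermore, for each $n<\omega$ the classes $\langle\bar{\mathcal K}\rangle_{\le n}$ and $\langle\bar{\mathcal K}\rangle_{=n}$ are amalgamation classes with the same modulus of stability.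
   Context: $\omega=\{0,1,2,\dots\}$, $\mathbb N=\omega\setminus\{0\}$. A multi-seminormed space is a vector space $X$ with a sequence of seminorms $(\|\cdot\|_{X,n})_{n<\lambda_X}$, where $1\le\lambda_X\le\omega$ is its length. It is separated if for every $x\neq 0$ some $\|x\|_{X,n}\ne 0$ (this is not required in general). For a seminorm $\|\cdot\|$ on $X$, $X_{\|\cdot\|}$ is the normed space $X/\ker\|\cdot\|$ with $\|[x]\|:=\|x\|$. $\langle\bar{\mathcal K}\rangle_{<\alpha}$, $\langle\bar{\mathcal K}\rangle_{\le\alpha}$, $\langle\bar{\mathcal K}\rangle_{=\alpha}$ are the classes of finite-dimensional separated multi-seminormed spaces $(X,(\|\cdot\|_n)_{n<\lambda_X})$ with $\lambda_X<\alpha$, $\lambda_X\le\alpha$, $\lambda_X=\alpha$ respectively, such that $X_{\|\cdot\|_n}\in\mathcal K_n$ for all $n<\lambda_X$. For $\delta\ge 0$, a multi-$\delta$-isometric embedding $f:X\to Y$ (where $\lambda_X\le\lambda_Y$) is an injective linear map such that $\frac1{1+\delta}\|x\|_{X,m}\le\|f(x)\|_{Y,m}\le(1+\delta)\|x\|_{X,m}$ for all $x\in X$, $m<\lambda_X$; for $\delta=0$ it is called a multi-isometric embedding, and $\mathrm{Emb}(X,Y)$ is the set of these. For linear $h:X\to Y$ and $n<\lambda_X\le\lambda_Y$, $\|h\|_n:=\sup\{\|h(x)\|_{Y,n}:\|x\|_{X,n}\le1\}$. A class $\mathcal K$ of finite-dimensional multi-seminormed spaces is hereditary if $X\in\mathcal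 K$ whenever $Y\in\mathcal K$ and $\mathrm{Emb}(X,Y)\neq\varnothing$. A modulus is a function $\varpi:\mathbb N\times(\mathbb N\cup\{\omega\})\times[0,\infty[\,\to[0,\infty[$ such that each $\varpi(d,l,\cdot)$ is increasing and continuous at $0$ with value $0$. $\mathcal K$ is an amalgamation class with modulus of stability $\varpi$ if $(\{0\},\|\cdot\|)\in\mathcal K$ and for every $d\in\mathbb N$, $l\in\mathbb N\cup\{\omega\}$, $\varepsilon>0$ and $\delta\ge0$, every $X,Y,Z\in\mathcal K$ such that $\dim X=d$ and $\lambda_X=l$, and every pair of multi-$\delta$-isometric embeddings $f_0:X\to Y$, $f_1:X\to Z$, there is a separated $W\in\mathcal K$ together with multi-isometric embeddings $g_0:Y\to W$, $g_1:Z\to W$ such that $\|g_0\circ f_0-g_1\circ f_1\|_n\le\varpi(d,l,\delta)+\varepsilon$ for each $n<\lambda_X$. For classes of finite-dimensional normed spaces the notions are the analogous ones: such a class $\mathcal C$ is hereditary if every normed space that embeds isometrically into a member of $\mathcal C$ is in $\mathcal C$; it is an amalgamation class with modulus of stability $\varpi^{\mathcal C}(d,\delta)$ (increasing in $\delta$ and continuous at $\delta=0$ with value $0$) if $\{0\}\in\mathcal C$ and for every $d$, $\varepsilon>0$, $\delta\ge0$, every $X,Y,Z\in\mathcal C$ with $\dim X=d$ and all $\delta$-isometric embeddings $f_0:X\to Y$, $f_1:X\to Z$ there are $W\in\mathcal C$ and isometric embeddings $g_0:Y\to W$, $g_1:Z\to W$ with $\|g_0\circ f_0-g_1\circ f_1\|\le\varpi^{\mathcal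 C}(d,\delta)+\varepsilon$.
   Formalization: In (a), hereditary is meant among separated spaces; in (b), α≥2 and n≥1, the zero space may have any length, and the formula max_{n<l} ϖ^{K_n}(d,δ) is for moduli nondecreasing in d; otherwise ϖ^{K_n}(d,δ) is replaced by max_{1≤k≤d} ϖ^{K_n}(k,δ). *)

(* Defs.v *)
From HB Require Import structures.
From mathcomp Require Import all_boot all_order all_algebra.
From mathcomp Require Import generic_quotient ring_quotient.
From mathcomp Require Import all_classical all_reals all_analysis.

Set Implicit Arguments.
Unset Strict Implicit.
Unset Printing Implicit Defensive.

Import Order.TTheory GRing.Theory Num.Theory.
Import numFieldNormedType.Exports.

Local Open Scope ring_scope.
Local Open Scope quotient_scope.

(* The ordinals alpha <= omega. *)
Inductive ordw := Fin of nat | Omega.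

Coercion Fin : nat >-> ordw.

Definition ltw (a b : ordw) : bool :=
  match a, b with
  | Fin m, Fin n => (m < n)%N
  | Fin _, Omega => true
  | Omega, _ => false
  end.

Definition lew (a b : ordw) : bool := ~~ ltw b a.

#[short(type="fdNormedType")]
HB.structure Definition FdNormed (R : numFieldType) :=
  {V of NormedModule R V & Vector R V}.

Record seminorm (R : realType) (V : lmodType R) := Seminorm {
  seminorm_fun :> V -> R;
  seminormD : forall x y : V,
    seminorm_fun (x + y) <= seminorm_fun x + seminorm_fun y;
  seminormZ : forall (a : R) (x : V), seminorm_fun (a *: x) = `|a| * seminorm_fun x
}.

Section SeminormTheory.
Variables (R : realType) (V : lmodType R) (p : seminorm V).

Lemma seminorm0 : p 0 = 0.
Proof. by rewrite -(scale0r 0) seminormZ normr0 mul0r. Qed.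

Lemma seminormN x : p (- x) = p x.
Proof. by rewrite -scaleN1r seminormZ normrN1 mul1r. Qed.

Lemma seminorm_ge0 x : 0 <= p x.
Proof.
have := seminormD p x (- x); rewrite subrr seminorm0 seminormN -mulr2n.
by rewrite pmulrn_lge0.
Qed.

Definition sker : {pred V} := [pred x | p x == 0].

Lemma skerP x : reflect (p x = 0) (x \in sker).
Proof. exact: eqP. Qed.

Lemma sker_zmod_closed : zmod_closed sker.
Proof.
split=> [|x y /skerP px /skerP py]; apply/skerP; first exact: seminorm0.
apply/eqP; rewrite eq_le seminorm_ge0 andbT.
by apply: le_trans (seminormD _ _ _) _; rewrite seminormN px py addr0.
Qed.

HB.instance Definition _ := GRing.isZmodClosed.Build V sker sker_zmod_closed.

Lemma seminorm_eqmod x y : x - y \in sker -> p x = p y.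
Proof.
move=> /skerP pxy; apply/eqP; rewrite eq_le; apply/andP; split.
  by rewrite -(subrK y x); apply: le_trans (seminormD _ _ _) _; rewrite pxy add0r.
rewrite -(subrK x y); apply: le_trans (seminormD _ _ _) _.
by rewrite -seminormN opprB pxy add0r.
Qed.

End SeminormTheory.

(* X_p, the normed space X / ker p. *)
Definition quotient_space (R : realType) (V : lmodType R) (p : seminorm V) : Type :=
  Quotient.quot (sker p : zmodClosed V).

Section QuotientSpace.
Variables (R : realType) (V : lmodType R) (p : seminorm V).
Local Notation Q := (quotient_space p).

HB.instance Definition _ := Choice.on Q.
HB.instance Definition _ := EqQuotient.on Q.
HB.instance Definition _ := GRing.Zmodule.on Q.

Definition quotient_class : V -> Q := \pi_Q.

Lemma quotient_classP x y :
  reflect (quotient_class x = quotient_class y) (x - y \in sker p).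
Proof. by rewrite Quotient.idealrBE; exact: eqP. Qed.

Lemma quotient_class_repr (q : Q) : quotient_class (repr q) = q.
Proof. exact: reprK. Qed.

Lemma quotient_classB : {morph quotient_class : x y / x - y}.
Proof. by move=> x y; rewrite /quotient_class !piE. Qed.

HB.instance Definition _ :=
  GRing.isZmodMorphism.Build V Q quotient_class quotient_classB.

Definition quotient_scale (a : R) (q : Q) : Q := quotient_class (a *: repr q).

Lemma quotient_scaleE a x :
  quotient_scale a (quotient_class x) = quotient_class (a *: x).
Proof.
apply/quotient_classP/skerP; rewrite -scalerBr seminormZ.
suff /skerP -> : repr (quotient_class x) - x \in sker p by rewrite mulr0.
exact/quotient_classP/quotient_class_repr.
Qed.

Fact quotient_scalerA a b q :
  quotient_scale a (quotient_scale b q) = quotient_scale (a * b) q.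
Proof. by rewrite -(quotient_class_repr q) !quotient_scaleE scalerA. Qed.

Fact quotient_scale1r : left_id 1 quotient_scale.
Proof. by move=> q; rewrite -(quotient_class_repr q) quotient_scaleE scale1r. Qed.

Fact quotient_scalerDr : right_distributive quotient_scale +%R.
Proof.
move=> a q r; rewrite -(quotient_class_repr q) -(quotient_class_repr r).
by rewrite -raddfD !quotient_scaleE scalerDr raddfD.
Qed.

Fact quotient_scalerDl q : {morph quotient_scale^~ q : a b / a + b}.
Proof.
by move=> a b; rewrite -(quotient_class_repr q) !quotient_scaleE scalerDl raddfD.
Qed.

HB.instance Definition _ := GRing.Zmodule_isLmodule.Build R Q
  quotient_scalerA quotient_scale1r quotient_scalerDr quotient_scalerDl.

Lemma quotient_classZ : scalable quotient_class.
Proof. by move=> a x; rewrite -quotient_scaleE. Qed.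

HB.instance Definition _ :=
  GRing.isScalable.Build R V Q *:%R quotient_class quotient_classZ.

Definition quotient_norm (q : Q) : R := p (repr q).

Lemma quotient_normE x : quotient_norm (quotient_class x) = p x.
Proof.
apply/seminorm_eqmod/quotient_classP; exact: quotient_class_repr.
Qed.

Fact quotient_normD q r :
  quotient_norm (q + r) <= quotient_norm q + quotient_norm r.
Proof.
rewrite -(quotient_class_repr q) -(quotient_class_repr r) -raddfD.
by rewrite !quotient_normE seminormD.
Qed.

Fact quotient_normZ (a : R) q : quotient_norm (a *: q) = `|a| * quotient_norm q.
Proof.
by rewrite -(quotient_class_repr q) -linearZ !quotient_normE seminormZ.
Qed.

Fact quotient_norm_eq0 q : quotient_norm q = 0 -> q = 0.
Proof.
rewrite -(quotient_class_repr q) quotient_normE => pq0.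
by rewrite -(raddf0 quotient_class); apply/quotient_classP/skerP; rewrite subr0.
Qed.

HB.instance Definition _ := Lmodule_isNormed.Build R Q
  quotient_normD quotient_normZ quotient_norm_eq0.

End QuotientSpace.

Section QuotientFinDim.
Variables (R : realType) (V : vectType R) (p : seminorm V).
Local Notation Q := (quotient_space p).

(* ker p, as a linear subspace. *)
Fact sker_vspace_subproof : exists U : {vspace V}, forall x, (x \in U) = (x \in sker p).
Proof.
pose P n := `[< exists U : {vspace V}, \dim U = n /\ {subset U <= sker p} >].
have P0 : exists n, P n.
  exists 0%N; apply/asboolP; exists 0%VS; split; first exact: dimv0.
  by move=> x; rewrite memv0 => /eqP ->; apply/skerP; exact: seminorm0.
have Pb n : P n -> (n <= \dim {:V})%N.
  by move=> /asboolP[U [<- _]]; exact/dimvS/subvf.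
case: (ex_maxnP P0 Pb) => n /asboolP[U [dU UK]] maxn.
exists U => x; apply/idP/idP => [/UK //|xK].
suff eqU : (U + <[x]>)%VS == U.
  by rewrite -(eqP eqU); apply: (subvP (addvSr _ _)); exact: memv_line.
rewrite eq_sym eqEdim addvSl /= dU; apply: maxn; apply/asboolP.
exists (U + <[x]>)%VS; split => // y /memv_addP[u uU [v /vlineP[k ->] ->]].
apply/skerP/eqP; rewrite eq_le seminorm_ge0 andbT.
apply: le_trans (seminormD _ _ _) _; rewrite seminormZ.
by move/UK/skerP: uU => ->; move/skerP: xK => ->; rewrite mulr0 addr0.
Qed.

Definition sker_vspace : {vspace V} := projT1 (cid sker_vspace_subproof).

Lemma mem_sker_vspace x : (x \in sker_vspace) = (x \in sker p).
Proof. exact: projT2 (cid sker_vspace_subproof) x. Qed.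

Local Notation S := (subvs_of (sker_vspace^C)%VS).

Let emb (s : S) : Q := quotient_class p (vsval s).

Fact quotient_findim_subproof : exists f : Q -> S, linear f /\ bijective f.
Proof.
have emb_lin a s t : emb (a *: s + t) = a *: emb s + emb t.
  by rewrite /emb !linearP.
have emb_inj : injective emb.
  move=> s t /quotient_classP; rewrite -mem_sker_vspace -linearB => h.
  have : vsval (s - t) \in (sker_vspace :&: sker_vspace^C)%VS.
    by rewrite memv_cap h subvsP.
  by rewrite capv_compl memv0 => /eqP e; apply/eqP; rewrite -subr_eq0; apply/eqP/val_inj.
have emb_surj q : exists s, emb s = q.
  have : repr q \in (sker_vspace + sker_vspace^C)%VS by rewrite addv_complf memvf.
  move=> /memv_addP[u uK [v vC e]]; exists (vsproj _ v).
  rewrite -[RHS]quotient_class_repr e; apply/quotient_classP.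
  by rewrite vsprojK// opprD addrCA subrr addr0 -mem_sker_vspace memvN.
pose f q := projT1 (cid (emb_surj q)).
have fK : cancel f emb by move=> q; exact: projT2 (cid (emb_surj q)).
have embK : cancel emb f by move=> s; apply: emb_inj; rewrite fK.
exists f; split; last by exists emb.
by move=> a q r; apply: emb_inj; rewrite emb_lin !fK.
Qed.

Fact quotient_vect_axiom : Vector.axiom (\dim (sker_vspace^C)%VS) Q.
Proof.
have [f [flin fbij]] := cid quotient_findim_subproof.
have [g glin gbij] := subvs_vect_iso (sker_vspace^C)%VS.
exists (g \o f); last exact: bij_comp.
by move=> a x y /=; rewrite flin glin.
Qed.

HB.instance Definition _ := Lmodule_hasFinDim.Build R Q quotient_vect_axiom.

End QuotientFinDim.

Definition opnorm (R : realType) (X Y : vectType R) (p : X -> R) (q : Y -> R)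
    (h : 'Hom(X, Y)) : \bar R :=
  ereal_sup [set (q (h x))%:E | x in [set x | p x <= 1]]%classic.

Definition delta_isometric_for (R : realType) (X Y : vectType R) (p : X -> R)
    (q : Y -> R) (delta : R) (f : X -> Y) : Prop :=
  forall x : X, (1 + delta)^-1 * p x <= q (f x) <= (1 + delta) * p x.

Definition delta_embedding (R : realType) (E F : fdNormedType R) (delta : R)
    (f : 'Hom(E, F)) : Prop :=
  injective f /\ delta_isometric_for Num.norm Num.norm delta f.

Definition isometric_embedding (R : realType) (E F : fdNormedType R)
    (f : 'Hom(E, F)) : Prop :=
  delta_embedding 0 f.

Definition isometric (R : realType) (E F : fdNormedType R) : Prop :=
  exists2 f : 'Hom(E, F), isometric_embedding f & bijective f.

Definition hereditary (R : realType) (K : fdNormedType R -> Prop) : Prop :=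
  forall E F : fdNormedType R,
    K F -> (exists f : 'Hom(E, F), isometric_embedding f) -> K E.

Definition is_modulus (R : realType) (w : R -> R) : Prop :=
  [/\ forall s, 0 <= s -> 0 <= w s,
      forall s t, 0 <= s -> s <= t -> w s <= w t,
      w 0 = 0 &
      (w t @[t --> 0^'+] --> (0 : R))%classic].

Definition amalgamation_class (R : realType) (K : fdNormedType R -> Prop)
    (w : nat -> R -> R) : Prop :=
  [/\ forall d : nat, (0 < d)%N -> is_modulus (w d),
      exists2 E : fdNormedType R, K E & \dim {: E} = 0%N &
      forall (d : nat) (eps delta : R), (0 < d)%N -> 0 < eps -> 0 <= delta ->
      forall X Y Z : fdNormedType R, K X -> K Y -> K Z -> \dim {: X} = d ->
      forall (f0 : 'Hom(X, Y)) (f1 : 'Hom(X, Z)),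
        delta_embedding delta f0 -> delta_embedding delta f1 ->
      exists W : fdNormedType R, K W /\
      exists (g0 : 'Hom(Y, W)) (g1 : 'Hom(Z, W)),
        [/\ isometric_embedding g0, isometric_embedding g1 &
            (opnorm Num.norm Num.norm ((g0 \o f0)%VF - (g1 \o f1)%VF)%R
               <= (w d delta + eps)%:E)%E]].

(* Only the seminorms of index n < length belong to the structure; the other
   values of [msnorm] play no role. *)
Record multiSeminormed (R : realType) := MultiSeminormed {
  mspace :> vectType R;
  mlength : ordw;
  mlength_gt0 : ltw 0%N mlength;
  msnorm : nat -> seminorm mspace
}.

Definition is_separated (R : realType) (X : multiSeminormed R) : Prop :=
  forall x : X, x != 0 -> exists2 n : nat, ltw n (mlength X) & msnorm X n x != 0.

Definition multi_delta_embedding (R : realType) (X Y : multiSeminormed R)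
    (delta : R) (f : 'Hom(X, Y)) : Prop :=
  [/\ lew (mlength X) (mlength Y), injective f &
      forall m : nat, ltw m (mlength X) ->
        delta_isometric_for (msnorm X m) (msnorm Y m) delta f].

Definition multi_embedding (R : realType) (X Y : multiSeminormed R)
    (f : 'Hom(X, Y)) : Prop :=
  multi_delta_embedding 0 f.

(* The separation of [X] has to be required: a multi-isometric embedding
   controls only the seminorms of index < length X, so when length X < length Y
   a non-separated [X] may embed in a separated [Y]. *)
Definition multi_hereditary (R : realType) (C : multiSeminormed R -> Prop) : Prop :=
  forall X Y : multiSeminormed R,
    C Y -> is_separated X -> (exists f : 'Hom(X, Y), multi_embedding f) -> C X.

(* The zero space is allowed to carry any number of (zero) seminorms. *)
Definition multi_amalgamation_class (R : realType)
    (C : multiSeminormed R -> Prop) (w : nat -> ordw -> R -> R) : Prop :=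
  [/\ forall (d : nat) (l : ordw), (0 < d)%N -> ltw 0%N l -> is_modulus (w d l),
      exists2 X : multiSeminormed R, C X & \dim {: X} = 0%N &
      forall (d : nat) (l : ordw) (eps delta : R),
        (0 < d)%N -> ltw 0%N l -> 0 < eps -> 0 <= delta ->
      forall X Y Z : multiSeminormed R, C X -> C Y -> C Z ->
        \dim {: X} = d -> mlength X = l ->
      forall (f0 : 'Hom(X, Y)) (f1 : 'Hom(X, Z)),
        multi_delta_embedding delta f0 -> multi_delta_embedding delta f1 ->
      exists W : multiSeminormed R, [/\ C W, is_separated W &
      exists (g0 : 'Hom(Y, W)) (g1 : 'Hom(Z, W)),
        [/\ multi_embedding g0, multi_embedding g1 &
            forall n : nat, ltw n (mlength X) ->
              (opnorm (msnorm X n) (msnorm W n) ((g0 \o f0)%VF - (g1 \o f1)%VF)%R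
                 <= (w d l delta + eps)%:E)%E]]].

(* The families K n are not assumed closed under isometry, so membership of the
   quotients is meant up to isometry. *)
Definition bracket (R : realType) (K : nat -> fdNormedType R -> Prop)
    (P : ordw -> Prop) (X : multiSeminormed R) : Prop :=
  [/\ is_separated X, P (mlength X) &
      forall n : nat, ltw n (mlength X) ->
        exists2 E : fdNormedType R, K n E &
          isometric (quotient_space (msnorm X n)) E].

Definition bracket_lt (R : realType) (K : nat -> fdNormedType R -> Prop)
    (a : ordw) : multiSeminormed R -> Prop :=
  bracket K (fun l => ltw l a).

Definition bracket_le (R : realType) (K : nat -> fdNormedType R -> Prop)
    (a : ordw) : multiSeminormed R -> Prop :=
  bracket K (fun l => lew l a).

Definition bracket_eq (R : realType) (K : nat -> fdNormedType R -> Prop)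
    (a : ordw) : multiSeminormed R -> Prop :=
  bracket K (fun l => l = a).

(* max_(n < l) w n d delta. For l = omega this supremum need not define a
   modulus, and the value 0 is a placeholder: a space of length omega occurs
   neither in a class with lengths < alpha <= omega nor in one with
   lengths <= n < omega. *)
Definition max_modulus (R : realType) (w : nat -> nat -> R -> R)
    (d : nat) (l : ordw) (delta : R) : R :=
  match l with
  | Fin m => \big[Num.max/0]_(n < m) w n d delta
  | Omega => 0
  end.

(* The quotients X_n of a space X of dimension d may have any smaller dimension
   k, for which w n d says nothing about w n k unless w n is monotone in the
   dimension. *)
Definition dim_monotone (R : realType) (w : nat -> R -> R) : Prop :=
  forall (k d : nat) (delta : R),
    (0 < k)%N -> (k <= d)%N -> 0 <= delta -> w k delta <= w d delta.

(* The least dimension-monotone function above w. *)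
Definition dim_envelope (R : realType) (w : nat -> R -> R) (d : nat) (delta : R) : R :=
  \big[Num.max/0]_(1 <= k < d.+1) w k delta.

(* Main.v *)
From HB Require Import structures.
Require Import Defs.
From mathcomp Require Import all_boot all_order all_algebra.
From mathcomp Require Import all_classical all_reals all_analysis.

Set Implicit Arguments.
Unset Strict Implicit.
Unset Printing Implicit Defensive.

Import Order.TTheory GRing.Theory Num.Theory.
Import VectorInternalTheory numFieldNormedType.Exports.

Local Open Scope ring_scope.

(** Everything happens one seminorm at a time. Membership of the quotient
    X_n in K_n up to isometry means that the n-th seminorm of X is pulled back
    from a norm: there is a linear map phi from X onto some E in K_n with
    |phi x| = ||x||_n ([isometric_quotientP]). Such maps are convenient
    substitutes for the quotients, since they compose with linear maps between
    multi-seminormed spaces.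

    (a) If f : X -> Y is a multi-isometric embedding and phi realizes the n-th
    seminorm of Y, then phi \o f realizes the n-th seminorm of X, so X_n embeds
    isometrically in a member of K_n ([bracket_hereditary]).

    (b) Multi-delta-isometric embeddings f0 : X -> Y, f1 : X -> Z descend to
    delta-isometric embeddings X_n -> Y_n, X_n -> Z_n, because f0 and f1 send
    the kernel of the n-th seminorm into the corresponding kernels. Amalgamate
    in K_n, for each n below the length of X, to get W_n
    ([seminorm_amalgamation]). For the n that are below the lengths of Y and Z
    only, or for which X_n = 0, one needs some W_n in K_n containing both Y_n
    and Z_n. This joint embedding property follows from amalgamation itself: of
    two nonzero spaces E, F in K_n with dim E <= dim F, the first maps
    injectively into the second, such a map is a delta-embedding for some large
    delta because norms on a finite-dimensional space are equivalent, and it can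
    be amalgamated with the identity of E ([joint_embedding]).
    Finally W is the product of the finitely many W_n with n < max(lambda_Y,
    lambda_Z), whose n-th seminorm is the norm of the n-th coordinate. It is
    separated, its n-th quotient is W_n, and the maps into the factors assemble
    to multi-isometric embeddings of Y and Z, injective because Y and Z are
    separated ([bracket_amalgam]).

    As X_n may have any dimension k <= d, the distance obtained in W_n is at
    most w_n(k, delta) + eps; it is below the stated modulus either since w_n
    is monotone in the dimension, or since it was replaced by its
    dimension-monotone envelope. *)

(** * Equivalence of norms in finite dimension *)

Section Seminorms.
Variable R : realType.

Definition norm_seminorm (E : normedModType R) : seminorm E :=
  Seminorm (@ler_normD R E) (@normrZ R E).

Section Comp.
Variables (U V : lmodType R) (f : {linear U -> V}) (p : seminorm V).

Fact seminorm_compD x y : p (f (x + y)) <= p (f x) + p (f y).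
Proof. by rewrite linearD seminormD. Qed.

Fact seminorm_compZ (a : R) x : p (f (a *: x)) = `|a| * p (f x).
Proof. by rewrite linearZ seminormZ. Qed.

Definition seminorm_comp : seminorm U := Seminorm seminorm_compD seminorm_compZ.
End Comp.

Lemma seminorm_sum (V : lmodType R) (p : seminorm V) n (F : 'I_n -> V) :
  p (\sum_i F i) <= \sum_i p (F i).
Proof.
elim/big_ind2 : _ => //; first by rewrite seminorm0.
by move=> x a y b xa yb; apply: le_trans (seminormD _ _ _) _; exact: lerD.
Qed.

Lemma seminorm_dist (V : lmodType R) (p : seminorm V) x y :
  `|p x - p y| <= p (x - y).
Proof.
have h u v : p u <= p v + p (u - v).
  by rewrite addrC -{1}(subrK v u) seminormD.
rewrite ler_norml lerBlDl h andbT lerBrDl lerBlDr (le_trans (h y x))//.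
by rewrite -(opprB x) seminormN.
Qed.

Lemma seminorm_rV_bound n (p : seminorm 'rV[R]_n) :
  exists2 C, 0 <= C & forall x, p x <= C * `|x|.
Proof.
exists (\sum_i p (delta_mx 0 i)); first by apply: sumr_ge0 => i _; exact: seminorm_ge0.
move=> x; rewrite {1}[x]row_sum_delta (le_trans (seminorm_sum _ _))// mulr_suml.
apply: ler_sum => i _; rewrite seminormZ mulrC ler_wpM2l ?seminorm_ge0//.
by rewrite [leRHS]/Num.Def.normr /= mx_normrE (le_bigmax _ (fun ij => `|x ij.1 ij.2|) (0, i)).
Qed.

Lemma seminorm_rV_continuous n (p : seminorm 'rV[R]_n) : continuous p.
Proof.
have [C C0 pC] := seminorm_rV_bound p.
move=> x; apply/(@cvgrPdist_lt _ _ _ (nbhs x) (nbhs_filter x)) => e e0.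
have C1 : 0 < C + 1 by rewrite ltr_wpDl.
apply/(@nbhs_normP _ _ x); exists (e / (C + 1)); first exact: divr_gt0.
move=> y /=; rewrite ltr_pdivlMr// mulrC => xy.
rewrite (le_lt_trans (seminorm_dist _ _ _))// (le_lt_trans (pC _))//.
by rewrite (le_lt_trans _ xy)// ler_wpM2r// lerDl.
Qed.

(** One half of the equivalence of norms on a finite-dimensional space: [p] is
    bounded by the sup norm, and the sup norm by [q], because [q] has a positive
    minimum on the compact unit sphere of the sup norm. *)
Lemma seminorm_rV_dominated n (p q : seminorm 'rV[R]_n) :
    (forall x, q x = 0 -> x = 0) ->
  exists2 C, 0 <= C & forall x, p x <= C * q x.
Proof.
move=> q0; have [Cp Cp0 pC] := seminorm_rV_bound p.
suff [c c0 qc] : exists2 c, 0 < c & forall x, c * `|x| <= q x.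
  exists (Cp / c); first by rewrite divr_ge0// ltW.
  move=> x; rewrite (le_trans (pC x))// -mulrA ler_wpM2l// mulrC.
  by rewrite ler_pdivlMr// mulrC.
pose S := [set x : 'rV[R]_n | `|x| = 1]%classic.
have [x0|/forallNP noS] := pselect (exists x : 'rV[R]_n, x != 0); last first.
  exists 1 => // x; have -> : x = 0 by apply/eqP; apply: contrapT => /negP; exact: noS.
  by rewrite normr0 mulr0 seminorm_ge0.
have nS x : x != 0 -> S (`|x|^-1 *: x).
  by move=> xn0; rewrite /S /= normrZ normfV normr_id mulVf// normr_eq0.
have cS : compact S.
  apply: bounded_closed_compact.
    by exists 1; split => // M M1 x /= ->; exact: ltW.
  rewrite (_ : S = Num.norm @^-1` [set 1])%classic//.
  apply: preimage_closed; last exact: closed_eq.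
  by move=> x _; apply: norm_continuous.
have S0 : (S !=set0)%classic by case: x0 => x /nS; exists (`|x|^-1 *: x).
have cq : {within S, continuous q}%classic.
  by apply: continuous_subspaceT; exact: seminorm_rV_continuous.
have [c cS1 qc] := EVT_min_rV S0 cS cq.
(* [q] is positive at the minimizer [c], which lies on the unit sphere. *)
have cn0 : c != 0.
  by apply/eqP => c0; move: cS1; rewrite inE /S /= c0 normr0 => /esym/eqP; rewrite oner_eq0.
exists (q c).
  rewrite lt_neqAle seminorm_ge0 andbT eq_sym; apply: contra cn0 => /eqP /q0 ->.
  by rewrite eqxx.
move=> x; have [->|xn0] := eqVneq x 0; first by rewrite normr0 mulr0 seminorm_ge0.
have /mem_set/qc := nS x xn0.
by rewrite seminormZ normfV normr_id mulrC ler_pdivlMr ?normr_gt0.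
Qed.

Lemma seminorm_dominated (V : vectType R) (p q : seminorm V) :
    (forall x, q x = 0 -> x = 0) ->
  exists2 C, 0 <= C & forall x, p x <= C * q x.
Proof.
move=> q0.
have q0' x : seminorm_comp (@r2v R V) q x = 0 -> x = 0.
  by move=> /q0 /eqP; rewrite -(linear0 (@r2v R V)) (inj_eq (can_inj r2vK)) => /eqP.
have [C C0 pq] := seminorm_rV_dominated (seminorm_comp (@r2v R V) p) q0'.
by exists C => // x; have := pq (v2r x); rewrite /= v2rK.
Qed.

End Seminorms.

(** * Seminorms pulled back from a norm *)

Section Isometric.
Variable R : realType.

Lemma delta_isometric_for0 (X Y : vectType R) (p : X -> R) (q : Y -> R) (f : X -> Y) :
  delta_isometric_for p q 0 f <-> forall x, q (f x) = p x.
Proof.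
rewrite /delta_isometric_for addr0 invr1.
split=> h x; last by rewrite !mul1r h lexx.
by apply/eqP; rewrite eq_le; have := h x; rewrite !mul1r andbC.
Qed.

Lemma lfun_definite_inj (X Y : vectType R) (f : 'Hom(X, Y)) :
  (forall x, f x = 0 -> x = 0) -> injective f.
Proof.
move=> f0 x y /eqP; rewrite -subr_eq0 -linearB => /eqP /f0 /eqP.
by rewrite subr_eq0 => /eqP.
Qed.

Lemma isometric_embeddingP (E F : fdNormedType R) (f : 'Hom(E, F)) :
  isometric_embedding f <-> forall x, `|f x| = `|x|.
Proof.
split=> [[_ /delta_isometric_for0]//|h]; split; last exact/delta_isometric_for0.
by apply: lfun_definite_inj => x fx0; apply: normr0_eq0; rewrite -h fx0 normr0.
Qed.

(** A map realizing [p] identifies [V / ker p] with the normed subspace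
    [limg phi] of [E]. *)
Definition realizes (V : vectType R) (p : seminorm V) (E : fdNormedType R)
  (phi : 'Hom(V, E)) := forall v, `|phi v| = p v.

(** [phi] kills exactly [ker p], so it factors through the quotient. *)
Lemma realizes_quotient_embedding (V : vectType R) (p : seminorm V)
    (E : fdNormedType R) (phi : 'Hom(V, E)) : realizes p phi ->
  exists2 f : 'Hom(quotient_space p, E),
    isometric_embedding f & forall v, f (quotient_class p v) = phi v.
Proof.
move=> phip; pose f (x : quotient_space p) := phi (repr x).
have fE v : f (quotient_class p v) = phi v.
  apply/eqP; rewrite -subr_eq0 -linearB -normr_eq0 phip.
  by apply/eqP/skerP/quotient_classP; rewrite quotient_class_repr.
have flin : linear f.
  move=> a x y; rewrite -(quotient_class_repr x) -(quotient_class_repr y).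
  by rewrite -linearP !fE linearP.
pose flm := GRing.isLinear.Build _ _ _ _ f flin.
pose fl : {linear _ -> _} := HB.pack f flm.
exists (linfun fl); last by move=> v; rewrite lfunE /= fE.
apply/isometric_embeddingP => x; rewrite lfunE /= -{1}(quotient_class_repr x).
by rewrite fE phip.
Qed.

Lemma isometric_quotientP (V : vectType R) (p : seminorm V) (E : fdNormedType R) :
  isometric (quotient_space p) E <->
  exists2 phi : 'Hom(V, E), realizes p phi & limg phi = fullv.
Proof.
split=> [[f /isometric_embeddingP fN [g gK fK]]|[phi phip phiT]].
  exists (linfun (f \o quotient_class p)) => [v|].
    by rewrite lfunE /= fN; exact: quotient_normE.
  apply/vspaceP => e; rewrite memvf -(fK e) -(quotient_class_repr (g e)).
  by rewrite (_ : f _ = linfun (f \o quotient_class p) (repr (g e))) ?memv_img ?memvf// lfunE.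
have [f fiso fE] := realizes_quotient_embedding phip.
exists f => //; exists (fun e => quotient_class p ((phi^-1)%VF e)) => [x|e].
  by apply: fiso.1; rewrite fE limg_lfunVK// phiT memvf.
by rewrite fE limg_lfunVK// phiT memvf.
Qed.

End Isometric.

(** * Amalgamating one seminorm *)

Section Amalgamation.
Variable R : realType.

(** Both [f] and its inverse on the image are bounded, by equivalence of norms
    applied to [x |-> `|f x|] and [x |-> `|x|]. *)
Lemma lfun_delta_embedding (E F : fdNormedType R) (f : 'Hom(E, F)) :
  injective f -> exists2 delta, 0 <= delta & delta_embedding delta f.
Proof.
move=> finj.
pose pf := seminorm_comp f (norm_seminorm F).
have pf0 x : pf x = 0 -> x = 0.
  by move=> /normr0_eq0; rewrite -(linear0 f) => /finj.
have [C C0 fC] := seminorm_dominated pf (q := norm_seminorm E) (@normr0_eq0 _ E).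
have [D D0 fD] := seminorm_dominated (norm_seminorm E) pf0.
exists (C + D); first exact: addr_ge0.
split=> // x; rewrite ler_pdivrMl ?ltr_pwDl ?addr_ge0//; apply/andP; split.
  apply: le_trans (fD x) _; apply: ler_wpM2r; first exact: normr_ge0.
  by rewrite addrA lerDr addr_ge0.
apply: le_trans (fC x) _; apply: ler_wpM2r; first exact: normr_ge0.
by rewrite addrCA lerDl addr_ge0.
Qed.

Lemma exists_injective_lfun (U V : vectType R) :
  (\dim {:U} <= \dim {:V})%N -> exists f : 'Hom(U, V), injective f.
Proof.
rewrite !dimvf => UV; pose J : 'M[R]_(dim U, dim V) := pid_mx (dim U).
exists (linfun (r2v \o mulmxr J \o v2r)) => x y; rewrite !lfunE /=.
move/(can_inj r2vK); move=> xy; apply: (can_inj v2rK); apply: row_free_inj xy.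
by rewrite /row_free rank_pid_mx.
Qed.

Variables (C : fdNormedType R -> Prop) (w : nat -> R -> R).
Hypothesis amC : amalgamation_class C w.

(** Amalgamation over [E] itself of the identity and of an injective linear map
    [E -> F], the latter being a delta-embedding for a large delta. *)
Lemma joint_embedding (E F : fdNormedType R) : C E -> C F ->
  exists W : fdNormedType R, C W /\ exists (g : 'Hom(E, W)) (h : 'Hom(F, W)),
    isometric_embedding g /\ isometric_embedding h.
Proof.
wlog EF : E F / (\dim {:E} <= \dim {:F})%N.
  move=> H CE CF; have [EF|/ltnW FE] := leqP (\dim {:E}) (\dim {:F}); first exact: H.
  by have [W [CW [g [h [gi hi]]]]] := H F E FE CF CE; exists W; split=> //; exists h, g.
move=> CE CF; have [f finj] := exists_injective_lfun EF.
have [E0|E0] := posnP (\dim {:E}).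
  exists F; split=> //; exists f, \1%VF; split; apply/isometric_embeddingP => x; last first.
    by rewrite id_lfunE.
  (* The amalgamation property only speaks of nonzero spaces; but 0 embeds
     in [F]. *)
  suff -> : x = 0 by rewrite linear0 !normr0.
  by apply/eqP; rewrite -memv0 -(eqP (_ : {:E}%VS == 0%VS)) ?memvf// -dimv_eq0 E0.
have [delta d0 fd] := lfun_delta_embedding finj.
have idd : delta_embedding delta (\1%VF : 'Hom(E, E)).
  split=> [x y|x]; rewrite !id_lfunE//.
  rewrite ler_pdivrMl ?ltr_pwDl// ler_peMl ?lerDl// ler_peMl// lerDl//.
have [_ _ am] := amC.
have [W [CW [g [h [gi hi _]]]]] := am _ 1 delta E0 ltr01 d0 E E F CE CE CF erefl _ _ idd fd.
by exists W; split=> //; exists g, h.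
Qed.

(** The amalgamation property of a class of normed spaces, carried over to
    seminorms whose quotients belong to the class. The quotient of [X] has an
    unspecified dimension between 0 and [\dim {:X}], whence the form of the bound
    [c]. *)
Lemma seminorm_amalgamation (X Y Z : vectType R)
    (p : seminorm X) (q : seminorm Y) (r : seminorm Z)
    (f0 : 'Hom(X, Y)) (f1 : 'Hom(X, Z)) (delta eps c : R) :
    (exists2 E, C E & isometric (quotient_space p) E) ->
    (exists2 E, C E & isometric (quotient_space q) E) ->
    (exists2 E, C E & isometric (quotient_space r) E) ->
    0 <= delta -> 0 < eps -> 0 <= c ->
    (forall k, (0 < k <= \dim {:X})%N -> w k delta <= c) ->
    delta_isometric_for p q delta f0 -> delta_isometric_for p r delta f1 ->
  exists W : fdNormedType R, C W /\ exists (G0 : 'Hom(Y, W)) (G1 : 'Hom(Z, W)),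
    [/\ realizes q G0, realizes r G1 &
        forall x, p x <= 1 -> `|G0 (f0 x) - G1 (f1 x)| <= c + eps].
Proof.
move=> [A CA /isometric_quotientP[phiX pX fullX]].
move=> [B CB /isometric_quotientP[phiY pY fullY]].
move=> [D CD /isometric_quotientP[phiZ pZ fullZ]].
move=> d0 e0 c0 wc f0d f1d.
(* If [p = 0], then [f0] and [f1] vanish for [q] and [r] and any joint
   embedding amalgamates them. *)
have [A0|A0] := posnP (\dim {:A}).
  have [W [CW [g [h [/isometric_embeddingP gi /isometric_embeddingP hi]]]]] :=
    joint_embedding CB CD.
  have p0 x : p x = 0.
    rewrite -pX; apply/eqP; rewrite normr_eq0 -memv0.
    by rewrite -(eqP (_ : {:A}%VS == 0%VS)) ?memvf// -dimv_eq0 A0.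
  have q0 x : q (f0 x) = 0.
    by apply/eqP; rewrite eq_le seminorm_ge0 andbT; have := f0d x; rewrite p0 !mulr0 => /andP[].
  have r0 x : r (f1 x) = 0.
    by apply/eqP; rewrite eq_le seminorm_ge0 andbT; have := f1d x; rewrite p0 !mulr0 => /andP[].
  exists W; split=> //; exists (g \o phiY)%VF, (h \o phiZ)%VF; split=> x.
  - by rewrite comp_lfunE gi pY.
  - by rewrite comp_lfunE hi pZ.
  rewrite !comp_lfunE (le_trans (ler_normB _ _))// gi hi pY pZ q0 r0 addr0.
  by rewrite addr_ge0// ltW.
have phiK a : phiX ((phiX^-1)%VF a) = a by rewrite limg_lfunVK// fullX memvf.
(* A delta-isometric [f] maps [ker p] to [ker s], so it induces a map between
   the quotients, which are represented by [A] and [F]. *)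
have descend (V : vectType R) (s : seminorm V) (f : 'Hom(X, V)) (F : fdNormedType R)
    (phi : 'Hom(V, F)) : realizes s phi -> delta_isometric_for p s delta f ->
    exists2 g : 'Hom(A, F), delta_embedding delta g & forall x, g (phiX x) = phi (f x).
  move=> phis fd; exists (phi \o f \o phiX^-1)%VF.
    have gd : delta_isometric_for Num.norm Num.norm delta (phi \o f \o phiX^-1)%VF.
      by move=> a; rewrite !comp_lfunE phis -{1 4}(phiK a) pX; exact: fd.
    split=> //; apply: lfun_definite_inj => a ga0; apply/eqP.
    rewrite -normr_le0; have /andP[+ _] := gd a.
    by rewrite ga0 normr0 ler_pdivrMl ?ltr_pwDl// mulr0.
  move=> x; rewrite !comp_lfunE; apply/eqP; rewrite -subr_eq0 -!linearB -normr_eq0 phis.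
  have px0 : p ((phiX^-1)%VF (phiX x) - x) = 0.
    by rewrite -pX linearB /= phiK subrr normr0.
  by have := fd ((phiX^-1)%VF (phiX x) - x); rewrite px0 !mulr0 -eq_le eq_sym.
have [F0 F0d F0E] := descend _ _ _ _ _ pY f0d.
have [F1 F1d F1E] := descend _ _ _ _ _ pZ f1d.
have [_ _ am] := amC.
have [W [CW [g [h [/isometric_embeddingP gi /isometric_embeddingP hi gh]]]]] :=
  am _ eps delta A0 e0 d0 A B D CA CB CD erefl _ _ F0d F1d.
exists W; split=> //; exists (g \o phiY)%VF, (h \o phiZ)%VF; split=> x.
- by rewrite comp_lfunE gi pY.
- by rewrite comp_lfunE hi pZ.
move=> px; rewrite !comp_lfunE -F0E -F1E.
have AX : (\dim {:A} <= \dim {:X})%N.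
  by rewrite -fullX -(limg_ker_dim phiX fullv) leq_addl.
apply: (@le_trans _ _ (w (\dim {:A}) delta + eps)); last by rewrite lerD2r wc// A0.
rewrite -lee_fin; apply: le_trans gh; apply: ereal_sup_ubound.
exists (phiX x); first by rewrite /= pX.
by rewrite add_lfunE opp_lfunE !comp_lfunE.
Qed.

End Amalgamation.

(** * Finite products *)

Section Product.
Variable R : realType.

(** The product of a finite family of vector spaces, concretely the row vectors
    obtained by concatenating coordinates in the factors. It is described by its
    universal property. *)
Lemma exists_product m (E : 'I_m -> vectType R) :
  exists (W : vectType R) (pi : forall i, 'Hom(W, E i)),
    (forall x, (forall i, pi i x = 0) -> x = 0) /\
    forall (V : vectType R) (g : forall i, 'Hom(V, E i)),
      exists G : 'Hom(V, W), forall i v, pi i (G v) = g i v.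
Proof.
pose N := (\sum_(i < m) dim (E i))%N.
have proj_lin i : linear (fun x : 'rV[R]_N => r2v (submxrow x i) : E i).
  move=> a x y; rewrite -linearP; congr r2v.
  by apply/matrixP => j k; rewrite !mxE.
pose pr i : {linear 'rV[R]_N -> E i} :=
  HB.pack (fun x : 'rV[R]_N => r2v (submxrow x i) : E i)
          (GRing.isLinear.Build _ _ _ _ (fun x : 'rV[R]_N => r2v (submxrow x i) : E i) (proj_lin i)).
have prE i x : linfun (pr i) x = r2v (submxrow x i) by rewrite lfunE.
have pr_inj x y : (forall i, linfun (pr i) x = linfun (pr i) y) -> x = y.
  by move=> xy; apply/mxrowP => i; have := xy i; rewrite !prE => /(can_inj r2vK).
exists 'rV[R]_N, (fun i => linfun (pr i)); split=> [x x0|V g].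
  by apply: pr_inj => i; rewrite x0 linear0.
pose G v : 'rV[R]_N := \mxrow_i v2r (g i v).
have GE i v : linfun (pr i) (G v) = g i v by rewrite prE mxrowK v2rK.
have Glin : linear G.
  move=> a u v; apply: pr_inj => i; rewrite linearP.
  apply: etrans (GE i _) _; rewrite linearP.
  by congr (_ *: _ + _); apply: esym; exact: GE.
pose Gl : {linear V -> 'rV[R]_N} := HB.pack G (GRing.isLinear.Build _ _ _ _ G Glin).
by exists (linfun Gl) => i v; rewrite (lfunE Gl) GE.
Qed.

(** The product of [E 0, ..., E m] becomes a multi-seminormed space of length
    [m.+1] whose n-th seminorm is the norm of the n-th coordinate. The
    projections are onto, so that the n-th quotient is [E n]. *)
Lemma exists_bracket_product (K : nat -> fdNormedType R -> Prop) (P : ordw -> Prop)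
    m (E : nat -> fdNormedType R) :
    (forall n, K n (E n)) -> P m.+1 ->
  exists (W : multiSeminormed R) (pi : forall i : 'I_m.+1, 'Hom(W, E i)),
    [/\ bracket K P W, mlength W = m.+1,
        forall i : 'I_m.+1, realizes (msnorm W i) (pi i),
        forall x, (forall i : 'I_m.+1, pi i x = 0) -> x = 0 &
        forall (V : vectType R) (g : forall i : 'I_m.+1, 'Hom(V, E i)),
          exists G : 'Hom(V, W), forall (i : 'I_m.+1) v, pi i (G v) = g i v].
Proof.
move=> KE Pm; have [W [pi [pi0 lift]]] := exists_product (fun i : 'I_m.+1 => E i).
(* [inord] extends the family of projections to all indices in [nat]; it agrees
   with the given one up to [m]. *)
pose N n := seminorm_comp (pi (inord n)) (norm_seminorm (E (inord n : 'I_m.+1))).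
have piN (i : 'I_m.+1) : realizes (N i) (pi i) by move=> x; rewrite /N inord_val.
pose WN := @MultiSeminormed R W m.+1 isT N.
exists WN, pi; split=> //; split=> // [x xn0|n nm].
  have [/pi0 x0|/existsNP[i /eqP xi0]] := pselect (forall i, pi i x = 0).
    by move: xn0; rewrite x0 eqxx.
  by exists i; [exact: ltn_ord|move: xi0; rewrite -normr_eq0 piN].
exists (E n) => //; apply/isometric_quotientP.
pose i : 'I_m.+1 := Ordinal nm; exists (pi i); first exact: (piN i).
(* The lift of the family that is the identity of [E i] in position [i] and 0
   elsewhere is a section of [pi i]. *)
pose T j := 'Hom(E i, E (nat_of_ord (j : 'I_m.+1))).
have [G GE] := lift _ (@dfwith _ T (fun=> 0) i \1%VF).
apply/vspaceP => e; rewrite memvf.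
have <- : pi i (G e) = e by rewrite GE dfwithin id_lfunE.
by rewrite memv_img ?memvf.
Qed.

End Product.

(** * Maxima of moduli *)

Section Moduli.
Variable R : realType.

Lemma is_modulus0 : is_modulus (fun _ : R => 0 : R).
Proof. by split=> //; exact: cvg_cst. Qed.

Lemma is_modulus_max (a b : R -> R) :
  is_modulus a -> is_modulus b -> is_modulus (fun s => Num.max (a s) (b s)).
Proof.
move=> [a0 am aa ac] [b0 bm bb bc]; split.
- by move=> s s0; rewrite le_max a0.
- by move=> s t s0 st; rewrite ge_max !le_max am//= bm// orbT.
- by rewrite aa bb maxxx.
have abc : (a t + b t @[t --> 0^'+] --> (0 : R))%classic.
  by rewrite -[X in (_ --> X)%classic](addr0 0); exact: cvgD.
apply: (squeeze_cvgr _ (cvg_cst 0) abc); near=> t.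
have t0 : 0 <= t by near: t; exact: nbhs_right_ge.
by rewrite le_max a0//= ge_max lerDl lerDr a0// b0.
Unshelve. all: by end_near. Qed.

Lemma is_modulus_bigmax (I : Type) (r : seq I) (P : pred I) (F : I -> R -> R) :
  (forall i, P i -> is_modulus (F i)) ->
  is_modulus (fun s => \big[Num.max/0]_(i <- r | P i) F i s).
Proof.
move=> Fmod; elim: r => [|i r IH].
  by under eq_fun do rewrite big_nil; exact: is_modulus0.
have [Pi|/negPf Pi] := boolP (P i); under eq_fun do rewrite big_cons Pi; last by [].
by apply: is_modulus_max => //; exact: Fmod.
Qed.

Variable w : nat -> nat -> R -> R.

Lemma is_modulus_max_modulus d l :
  (forall n, is_modulus (w n d)) -> is_modulus (max_modulus w d l).
Proof.
move=> wmod; case: l => [m|]; last exact: is_modulus0.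
exact: is_modulus_bigmax.
Qed.

Lemma is_modulus_dim_envelope n d :
  (forall k, (0 < k)%N -> is_modulus (w n k)) -> is_modulus (dim_envelope (w n) d).
Proof.
move=> wmod; rewrite /dim_envelope; under eq_fun do rewrite big_nat.
by apply: is_modulus_bigmax => k /andP[+ _]; exact: wmod.
Qed.

Lemma le_max_modulus d m n delta : (n < m)%N -> w n d delta <= max_modulus w d m delta.
Proof. by move=> nm; exact: (le_bigmax _ (fun i : 'I_m => w i d delta) (Ordinal nm)). Qed.

Lemma le_dim_envelope n d k delta : (0 < k <= d)%N ->
  w n k delta <= dim_envelope (w n) d delta.
Proof.
move=> kd; apply: (@le_bigmax_seq _ _ _ _ _ k xpredT (w n ^~ delta)) => //.
by rewrite mem_index_iota ltnS.
Qed.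

End Moduli.

(** * Classes of multi-seminormed spaces *)

Section Bracket.
Variables (R : realType) (K : nat -> fdNormedType R -> Prop) (P : ordw -> Prop).

Lemma ltw_lew_trans a b c : ltw a b -> lew b c -> ltw a c.
Proof.
case: a b c => [a|] [b|] [c|] //=; rewrite /lew /= -leqNgt; exact: leq_trans.
Qed.

Lemma bracket_hereditary :
    (forall n, hereditary (K n)) -> (forall a b, lew a b -> P b -> P a) ->
  multi_hereditary (bracket K P).
Proof.
move=> hK hP X Y [_ PY KY] sepX [f [XY finj fiso]]; split=> //; first exact: hP XY PY.
move=> n nX; have nY := ltw_lew_trans nX XY.
have [F KF /isometric_quotientP[phi phiY _]] := KY n nY.
have [g giso _] := @realizes_quotient_embedding _ _ (msnorm X n) _ (phi \o f)%VF
  (fun x => etrans (congr1 Num.norm (comp_lfunE _ _ _))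
     (etrans (phiY _) ((delta_isometric_for0 _ _ _).1 (fiso n nX) x))).
exists (quotient_space (msnorm X n)); first by apply: hK KF _; exists g.
exists \1%VF; first by apply/isometric_embeddingP => x; rewrite id_lfunE.
by exists id => x; rewrite id_lfunE.
Qed.

Variables (w : nat -> nat -> R -> R) (m : nat -> ordw -> R -> R).
Hypothesis amK : forall n, amalgamation_class (K n) (w n).
Hypothesis P_finite : ~ P Omega.
Hypothesis P_maxn : forall a b : nat, P a -> P b -> P (maxn a b).
Hypothesis m_modulus : forall d l, (0 < d)%N -> is_modulus (m d l).
Hypothesis w_le_m : forall (d k l n : nat) delta, (n < l)%N -> (0 < k <= d)%N ->
  0 <= delta -> w n k delta <= m d l delta.

Let zero_space n : exists2 E, K n E & \dim {:E} = 0%N.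
Proof. by have [] := amK n. Qed.

Lemma bracket_zero_space l : P l.+1 ->
  exists2 X : multiSeminormed R, bracket K P X & \dim {:X} = 0%N.
Proof.
move=> Pl; have /choice[E EK] n : exists E, K n E /\ \dim {:E} = 0%N.
  by have [E] := zero_space n; exists E.
have [X [pr [XK _ _ sep _]]] := exists_bracket_product (fun n => (EK n).1) Pl.
exists X => //; apply/eqP; rewrite dimv_eq0 -subv0; apply/subvP => x _.
rewrite memv0; apply/eqP/sep => i; apply/eqP.
by rewrite -memv0 -(eqP (_ : {:E i}%VS == 0%VS)) ?memvf// -dimv_eq0 (EK i).2.
Qed.

(** [c] stands for the value of the modulus; by [w_le_c] it bounds the moduli of
    all the quotients of [X]. *)
Section Amalgam.
Variables (X Y Z : multiSeminormed R) (f0 : 'Hom(X, Y)) (f1 : 'Hom(X, Z)).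
Variables (delta eps c : R).
Hypotheses (KX : bracket K P X) (KY : bracket K P Y) (KZ : bracket K P Z).
Hypotheses (delta0 : 0 <= delta) (eps0 : 0 < eps) (c0 : 0 <= c).
Hypotheses (f0d : multi_delta_embedding delta f0) (f1d : multi_delta_embedding delta f1).
Hypothesis w_le_c : forall n k : nat, ltw n (mlength X) -> (0 < k <= \dim {:X})%N ->
  w n k delta <= c.

(** The n-th factor of the amalgam. According to which of the lengths exceed [n],
    it comes from the amalgamation of [X_n -> Y_n] and [X_n -> Z_n], from a joint
    embedding of [Y_n] and [Z_n], or it is [Y_n], [Z_n] or 0. *)
Lemma coordinate_amalgamation (n : nat) :
  exists W : fdNormedType R, K n W /\ exists (G0 : 'Hom(Y, W)) (G1 : 'Hom(Z, W)),
    [/\ ltw n (mlength Y) -> realizes (msnorm Y n) G0,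
        ltw n (mlength Z) -> realizes (msnorm Z n) G1 &
        ltw n (mlength X) ->
          forall x, msnorm X n x <= 1 -> `|G0 (f0 x) - G1 (f1 x)| <= c + eps].
Proof.
have [XY _ f0n] := f0d; have [XZ _ f1n] := f1d.
have [_ _ /(_ n) KXn] := KX; have [_ _ /(_ n) KYn] := KY; have [_ _ /(_ n) KZn] := KZ.
have [nX|nX] := boolP (ltw n (mlength X)).
  have nY := ltw_lew_trans nX XY; have nZ := ltw_lew_trans nX XZ.
  have [W [KW [G0 [G1 [G0Y G1Z G01]]]]] := seminorm_amalgamation (amK n)
    (KXn nX) (KYn nY) (KZn nZ) delta0 eps0 c0 (fun k => w_le_c nX) (f0n n nX) (f1n n nX).
  by exists W; split=> //; exists G0, G1.
have [nY|nY] := boolP (ltw n (mlength Y)); last first.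
  have [nZ|nZ] := boolP (ltw n (mlength Z)); last first.
    by have [E KE _] := zero_space n; exists E; split=> //; exists 0, 0.
  have [E KE /isometric_quotientP[phi phiZ _]] := KZn nZ.
  by exists E; split=> //; exists 0, phi.
have [E KE /isometric_quotientP[phi phiY _]] := KYn nY.
have [nZ|nZ] := boolP (ltw n (mlength Z)); last first.
  by exists E; split=> //; exists phi, 0.
have [F KF /isometric_quotientP[psi psiZ _]] := KZn nZ.
have [W [KW [g [h [/isometric_embeddingP gi /isometric_embeddingP hi]]]]] :=
  joint_embedding (amK n) KE KF.
exists W; split=> //; exists (g \o phi)%VF, (h \o psi)%VF; split=> // _ v.
  by rewrite comp_lfunE gi phiY.
by rewrite comp_lfunE hi psiZ.
Qed.

(** The product of the coordinatewise amalgams, of length the maximum of the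
    lengths of [Y] and [Z]. *)
Lemma bracket_amalgam :
  exists W : multiSeminormed R, [/\ bracket K P W, is_separated W &
  exists (g0 : 'Hom(Y, W)) (g1 : 'Hom(Z, W)),
    [/\ multi_embedding g0, multi_embedding g1 &
        forall n : nat, ltw n (mlength X) ->
          (opnorm (msnorm X n) (msnorm W n) ((g0 \o f0)%VF - (g1 \o f1)%VF)%R
             <= (c + eps)%:E)%E]].
Proof.
have finite_length V : bracket K P V -> exists2 l, mlength V = Fin l & (0 < l)%N.
  case=> _; have := mlength_gt0 V; case: (mlength V) => [l|//] l0 _ _.
  by exists l.
have [b Yb b0] := finite_length _ KY; have [a Za a0] := finite_length _ KZ.
have [l lE] : exists l, l.+1 = maxn b a.
  by exists (maxn b a).-1; rewrite prednK// leq_max b0.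
have Pl : P l.+1.
  by rewrite lE; apply: P_maxn; [rewrite -Yb; case: KY|rewrite -Za; case: KZ].
have /choice[E EP] := coordinate_amalgamation.
have [W [pr [KW Wl prN sep lift]]] := exists_bracket_product (fun n => (EP n).1) Pl.
pose G0 n := projT1 (cid (EP n).2).
pose G1 n := projT1 (cid (projT2 (cid (EP n).2))).
have GP (n : nat) : [/\ ltw n (mlength Y) -> realizes (msnorm Y n) (G0 n),
    ltw n (mlength Z) -> realizes (msnorm Z n) (G1 n) &
    ltw n (mlength X) ->
      forall x, msnorm X n x <= 1 -> `|G0 n (f0 x) - G1 n (f1 x)| <= c + eps].
  exact: projT2 (cid (projT2 (cid (EP n).2))).
have [g0 g0E] := lift Y (fun i => G0 i); have [g1 g1E] := lift Z (fun i => G1 i).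
(* A map into the product that is isometric in every coordinate below the
   length of a separated [V] is injective: a vector in its kernel has all its
   seminorms equal to 0. *)
have embed (V : multiSeminormed R) (g : 'Hom(V, W)) (G : forall n, 'Hom(V, E n)) :
    is_separated V -> lew (mlength V) l.+1 ->
    (forall n : nat, ltw n (mlength V) -> realizes (msnorm V n) (G n)) ->
    (forall (i : 'I_l.+1) v, pr i (g v) = G i v) -> multi_embedding g.
  move=> sepV Vl GV gE.
  have gN (n : nat) : ltw n (mlength V) -> forall v, msnorm W n (g v) = msnorm V n v.
    move=> nV v; have nl : (n < l.+1)%N := ltw_lew_trans nV Vl.
    by rewrite -(GV n nV) -(gE (Ordinal nl)) (prN (Ordinal nl)).
  split=> [||n nV]; [by rewrite Wl| |exact/delta_isometric_for0/gN].
  apply: lfun_definite_inj => v gv0; apply/eqP; apply: contrapT => /negP/sepV[n nV].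
  by rewrite -gN// gv0 seminorm0 eqxx.
exists W; split=> //; first by case: KW.
exists g0, g1; split.
- apply: (embed _ _ G0) => //; [by case: KY| |by move=> n; case: (GP n)].
  by rewrite Yb lE /lew /= -leqNgt leq_maxl.
- apply: (embed _ _ G1) => //; [by case: KZ| |by move=> n; case: (GP n)].
  by rewrite Za lE /lew /= -leqNgt leq_maxr.
move=> n nX; have [_ _ /(_ nX) G01] := GP n.
have nl : (n < l.+1)%N.
  have [XY _ _] := f0d; have := ltw_lew_trans nX XY.
  by rewrite Yb lE leq_max /= => ->.
apply: ge_ereal_sup => _ [x xn <-]; rewrite lee_fin.
rewrite -(prN (Ordinal nl)) add_lfunE opp_lfunE !comp_lfunE linearB.
by have := G01 x xn; rewrite -(g0E (Ordinal nl)) -(g1E (Ordinal nl)).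
Qed.

End Amalgam.

(** The classes of lengths [< alpha], [<= n] and [= n] have in common that their
    lengths are finite and closed under maximum, and that some length occurs. *)
Lemma bracket_amalgamation_class l : P l.+1 -> multi_amalgamation_class (bracket K P) m.
Proof.
move=> Pl; split=> [d k d0 _||]; [exact: m_modulus|exact: bracket_zero_space Pl|].
move=> d l' eps delta d0 _ eps0 delta0 X Y Z KX KY KZ Xd Xl f0 f1 f0d f1d.
apply: (bracket_amalgam KX KY KZ delta0 eps0 _ f0d f1d).
  by have [+ _ _ _] := m_modulus l' d0; exact.
move=> n k nX; rewrite Xd => kd; move: nX; rewrite Xl.
case: l' Xl => [l' _|]; first by move=> nl'; exact: w_le_m.
by case: KX => _ + _ => + XO; rewrite XO => /P_finite.
Qed.

End Bracket.

(** * The two moduli of stability *)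

Lemma max_dim_envelope_amalgamation (R : realType) (K : nat -> fdNormedType R -> Prop)
    (w : nat -> nat -> R -> R) (P : ordw -> Prop) (l : nat) :
    (forall n, amalgamation_class (K n) (w n)) -> ~ P Omega ->
    (forall a b : nat, P a -> P b -> P (maxn a b)) -> P l.+1 ->
  multi_amalgamation_class (bracket K P)
    (max_modulus (fun i => dim_envelope (w i))).
Proof.
move=> amK PO Pmax; apply: (bracket_amalgamation_class amK PO Pmax).
  move=> d k d0; apply: is_modulus_max_modulus => n.
  by apply: is_modulus_dim_envelope => j j0; have [+ _ _] := amK n; exact.
move=> d k j n delta nj kd _; apply: le_trans (le_max_modulus _ _ _ nj).
exact: le_dim_envelope.
Qed.

Lemma max_modulus_amalgamation (R : realType) (K : nat -> fdNormedType R -> Prop)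
    (w : nat -> nat -> R -> R) (P : ordw -> Prop) (l : nat) :
    (forall n, amalgamation_class (K n) (w n)) -> (forall n, dim_monotone (w n)) ->
    ~ P Omega -> (forall a b : nat, P a -> P b -> P (maxn a b)) -> P l.+1 ->
  multi_amalgamation_class (bracket K P) (max_modulus w).
Proof.
move=> amK wmono PO Pmax; apply: (bracket_amalgamation_class amK PO Pmax).
  by move=> d k d0; apply: is_modulus_max_modulus => n; have [+ _ _] := amK n; exact.
move=> d k j n delta nj /andP[k0 kd] delta0.
by apply: le_trans (le_max_modulus _ _ _ nj); exact: wmono.
Qed.

Theorem proposition2p6 (R : realType) (K : nat -> fdNormedType R -> Prop) :
  ((forall n : nat, hereditary (K n)) ->
   forall alpha : ordw,
     multi_hereditary (bracket_lt K alpha) /\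
     multi_hereditary (bracket_le K alpha))
  /\
  (forall w : nat -> nat -> R -> R,
   (forall n : nat, amalgamation_class (K n) (w n)) ->
   ((forall n : nat, dim_monotone (w n)) ->
      (forall alpha : ordw, ltw 1%N alpha ->
         multi_amalgamation_class (bracket_lt K alpha) (max_modulus w)) /\
      (forall n : nat, (0 < n)%N ->
         multi_amalgamation_class (bracket_le K n) (max_modulus w) /\
         multi_amalgamation_class (bracket_eq K n) (max_modulus w)))
   /\
   (forall alpha : ordw, ltw 1%N alpha ->
      multi_amalgamation_class (bracket_lt K alpha)
        (max_modulus (fun i => dim_envelope (w i)))) /\
   (forall n : nat, (0 < n)%N ->
      multi_amalgamation_class (bracket_le K n)
        (max_modulus (fun i => dim_envelope (w i))) /\
      multi_amalgamation_class (bracket_eq K n)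
        (max_modulus (fun i => dim_envelope (w i))))).
Proof.
have lt_max alpha (a b : nat) : ltw a alpha -> ltw b alpha -> ltw (maxn a b) alpha.
  by case: alpha => //= n an bn; rewrite gtn_max an.
have le_max (n a b : nat) : lew a n -> lew b n -> lew (maxn a b) n.
  by rewrite /lew /= -!leqNgt geq_max => -> ->.
have eq_max (n a b : nat) : Fin a = n -> Fin b = n -> Fin (maxn a b) = n.
  by move=> [->] [->]; rewrite maxnn.
have le1 n : (0 < n)%N -> lew 1%N n by rewrite /lew /= -leqNgt.
have eq1 n : (0 < n)%N -> Fin n.-1.+1 = n by move=> n0; rewrite prednK.
split=> [hK alpha|w amK].
  split; apply: bracket_hereditary => // -[a|] [b|]; case: alpha => [c|] //=;
    rewrite /lew /= -?leqNgt; [exact: leq_ltn_trans|exact: leq_trans].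
split=> [wmono|]; split=> [alpha alpha1|n n0].
- by apply: (@max_modulus_amalgamation _ _ _ _ 0) => // a b; exact: lt_max.
- split; first by apply: (@max_modulus_amalgamation _ _ _ _ 0) => // [a b|];
    [exact: le_max|exact: le1].
  by apply: (@max_modulus_amalgamation _ _ _ _ n.-1) => // [a b|];
    [exact: eq_max|exact: eq1].
- by apply: (@max_dim_envelope_amalgamation _ _ _ _ 0) => // a b; exact: lt_max.
- split; first by apply: (@max_dim_envelope_amalgamation _ _ _ _ 0) => // [a b|];
    [exact: le_max|exact: le1].
  by apply: (@max_dim_envelope_amalgamation _ _ _ _ n.-1) => // [a b|];
    [exact: eq_max|exact: eq1].
Qed.
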